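(* There is $n_0$ such that for every $n\ge n_0$ Waiter has a winning strategy in the unbiased Waiter-Client maximum degree game $WC_\Delta(n,D)$ with $$D=\frac{n}{2}+\frac{\sqrt{n\ln n}}{500}.$$
   Context: The game $WC_\Delta(n,D)$ (unbiased, i.e. bias $q=1$) is a two-player perfect information game played on the edges of the complete graph $K_n$. In each round Waiter offers Client $2$ edges of $K_n$ that have not been previously offered; Client claims one of them and Waiter claims the other. When fewer than $2$ not previously offered edges remain, Waiter claims all of them and the game ends. Client wins if and only if at the end of the game every vertex has degree smaller than $D$ in the graph formed by the edges claimed by Client; otherwise (some vertex has degree at least $D$ in Client's graph) Waiter wins. Here $D$ is a real threshold. *)

(* Defs.v *)
From mathcomp Require Import all_boot all_order all_algebra.
From mathcomp Require Import reals exp.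

Set Implicit Arguments.
Unset Strict Implicit.
Unset Printing Implicit Defensive.

Import Order.TTheory GRing.Theory Num.Theory.
Local Open Scope ring_scope.

Section WaiterClientMaxDegree.
Variable n : nat.

Definition edge : predArgType := {set 'I_n}.

Definition complete_edges : {set edge} := [set e : edge | #|e| == 2].

(* A round is recorded as (edge claimed by Client, edge claimed by Waiter);
   a history lists the rounds played so far in chronological order. *)
Definition round : Type := (edge * edge)%type.
Definition history : Type := seq round.

Definition offered_edges (h : history) : seq edge := unzip1 h ++ unzip2 h.

Definition free_edges (h : history) : {set edge} :=
  [set e in complete_edges | e \notin offered_edges h].

Definition client_graph (h : history) : {set edge} :=
  [set e : edge | e \in unzip1 h].

Definition degree (G : {set edge}) (v : 'I_n) : nat :=
  #|[set e in G | v \in e]|.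

(* The edge that may remain after the last round goes to Waiter and so does
   not affect Client's graph. *)
Definition game_over (h : history) : bool := (#|free_edges h| < 2)%N.

Definition legal_offer (h : history) (o : edge * edge) : bool :=
  [&& o.1 != o.2, o.1 \in free_edges h & o.2 \in free_edges h].

Definition waiter_strategy : Type := history -> edge * edge.

(* The histories that can arise when Waiter follows s: in each round Client may
   claim either of the two offered edges. *)
Inductive consistent (s : waiter_strategy) : history -> Prop :=
| consistent_start : consistent s [::]
| consistent_fst h : consistent s h -> ~~ game_over h ->
    consistent s (rcons h ((s h).1, (s h).2))
| consistent_snd h : consistent s h -> ~~ game_over h ->
    consistent s (rcons h ((s h).2, (s h).1)).

Definition legal_strategy (s : waiter_strategy) : Prop :=
  forall h, consistent s h -> ~~ game_over h -> legal_offer h (s h).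

Variables (R : realType) (D : R).

Definition client_wins (h : history) : bool :=
  [forall v : 'I_n, (degree (client_graph h) v)%:R < D].

(* A legal offer uses up two free edges, so every play consistent with a legal
   strategy reaches game_over. *)
Definition winning_strategy (s : waiter_strategy) : Prop :=
  legal_strategy s /\
  forall h, consistent s h -> game_over h -> ~~ client_wins h.

Definition waiter_wins_WC : Prop := exists s, winning_strategy s.

End WaiterClientMaxDegree.

(* Main.v *)
(* Call the level of a vertex its Client degree plus half the number of its
   free edges, doubled. A vertex of level K can be brought to Client degree
   about K / 2 by offering its free edges in pairs. To reach a high level,
   Waiter splits the vertices into halves A and B and, for each u in B, offers
   pairs ua, ua' with a, a' in A of equal level: one level goes up by 1, the
   other down by 1. This imitates n/2 steps of |A| random walks, whose maximum
   has order sqrt (n ln n). Formally, sum_(a in A) x ^ level a with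
   x = 1 + sqrt (ln n / n) grows by a factor 1 + (x - 1)^2 / (2 x) with every
   u, up to the contribution of unpaired vertices; at most one vertex per level
   is unpaired, so that is at most x ^ K / (x - 1) while all levels are below
   K. After n/2 steps the sum exceeds |A| x ^ K, so level K was reached. *)
Require Import Defs.
From mathcomp Require Import all_boot all_order all_algebra.
From mathcomp Require Import boolp reals sequences exp.
From mathcomp Require Import ring lra zify.

Set Implicit Arguments.
Unset Strict Implicit.
Unset Printing Implicit Defensive.

Import Order.TTheory GRing.Theory Num.Theory.
Local Open Scope ring_scope.

(** * Forcing a property of the history in finitely many rounds *)

Section Game.
Variable n : nat.
Implicit Types (h : history n) (e f : edge n) (u v : 'I_n) (G : {set edge n}).

(** A well-founded tree of offers takes the place of a strategy function, so that successive stages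
    of Waiter's play compose by [forces_bind]. *)
Inductive forces (Q : history n -> Prop) : history n -> Prop :=
| forces_now h : Q h -> forces Q h
| forces_offer h e f : legal_offer h (e, f) ->
    forces Q (rcons h (e, f)) -> forces Q (rcons h (f, e)) -> forces Q h.

Lemma forces_bind (P Q : history n -> Prop) h :
  forces P h -> (forall h', P h' -> forces Q h') -> forces Q h.
Proof.
move=> + PQ; elim=> {h} [h /PQ //|h e f leg _ IHe _ IHf].
exact: forces_offer leg IHe IHf.
Qed.

Lemma legal_offerC h e f : legal_offer h (f, e) = legal_offer h (e, f).
Proof. by rewrite /legal_offer /= eq_sym [X in _ && X]andbC. Qed.

(** Waiter always picks some offer after which [Q] is still forced. Once the game is over no offer
    is legal, so there [Q] itself must hold. *)
Lemma forces_waiter_wins (R : realType) (D : R) :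
  forces (fun h => game_over h && ~~ client_wins D h) [::] ->
  waiter_wins_WC n D.
Proof.
set Q := fun h => _; move=> Q0.
pose good h (o : edge n * edge n) :=
  [/\ legal_offer h o, forces Q (rcons h (o.1, o.2))
    & forces Q (rcons h (o.2, o.1))].
(* The default is never played: a good offer exists whenever [Q] is forced and the game is not
   over. *)
pose s h := odflt (set0, set0) [pick o | `[< good h o >]].
have goodP h : forces Q h -> ~~ game_over h -> good h (s h).
  move=> Qh hN; rewrite /s; case: pickP => [o /asboolP //|nogood].
  case: Qh hN nogood => [h' /andP[-> //]|h' e f leg Qe Qf _ /(_ (e, f))].
  by move/negbT/asboolPn; case.
have inv h : consistent s h -> forces Q h.
  elim=> {h} [//|h _ Qh hN|h _ Qh hN]; by case: (goodP h Qh hN).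
exists s; split=> [h /inv Qh hN|h /inv Qh]; first by case: (goodP h Qh hN).
case: Qh => {h} [h /andP[] //|h e f /and3P[/= ef eh fh] _ _].
by rewrite /game_over ltnNge (cardsD1 e) eh (cardsD1 f) in_setD1 eq_sym ef fh.
Qed.

(** * Degrees and levels under one round *)

Lemma degreeE G v : degree G v = (\sum_(e in G) (v \in e))%N.
Proof.
rewrite /degree -sum1_card big_mkcond [RHS]big_mkcond.
by apply: eq_bigr => e _; rewrite inE; case: (e \in G); case: (v \in e).
Qed.

Lemma free_edges_rcons h e f :
  free_edges (rcons h (e, f)) = free_edges h :\ e :\ f.
Proof.
apply/setP=> g; rewrite !inE /offered_edges /unzip1 /unzip2 !map_rcons.
rewrite !mem_cat !mem_rcons !inE.
by case: (g == e); case: (g == f); rewrite /= ?orbT ?andbF.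
Qed.

Lemma client_graph_rcons h e f :
  client_graph (rcons h (e, f)) = e |: client_graph h.
Proof. by apply/setP=> g; rewrite !inE /unzip1 map_rcons mem_rcons. Qed.

(* Twice Client's degree at [v] if Client gets half of the edges at [v] that
   are still free. *)
Definition level h v : nat :=
  2 * degree (client_graph h) v + degree (free_edges h) v.

(** Client's edge gains 2 and loses 1 as a free edge; Waiter's edge only loses 1. The additive form
    avoids truncated subtraction. *)
Lemma level_rcons h e f v : legal_offer h (e, f) ->
  (level (rcons h (e, f)) v + (v \in f) = level h v + (v \in e))%N.
Proof.
move=> /and3P[/= ef eh fh].
have eC : e \notin client_graph h.
  by move: eh; rewrite !inE mem_cat negb_or => /andP[_ /andP[]].
have feh : f \in free_edges h :\ e by rewrite in_setD1 eq_sym ef.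
rewrite /level client_graph_rcons free_edges_rcons !degreeE big_setU1 //=.
rewrite [in RHS](big_setD1 e eh) [in RHS](big_setD1 f feh) /=.
set c := (\sum_(g in client_graph h) _)%N; set d := (\sum_(g in _) _)%N.
by case: (v \in e); case: (v \in f); lia.
Qed.

Lemma degree_client_rcons h e f v :
  (degree (client_graph h) v <= degree (client_graph (rcons h (e, f))) v)%N.
Proof.
rewrite client_graph_rcons; apply: subset_leq_card.
by apply/subsetP=> g; rewrite !inE => /andP[-> ->]; rewrite orbT.
Qed.

Lemma level0 v : (n.-1 <= level [::] v)%N.
Proof.
have inj : {in [set~ v] &, injective (fun w => [set v; w])}.
  move=> w w'; rewrite !inE => wv w'v /setP/(_ w).
  by rewrite !inE eqxx orbT (negPf wv) => /esym/eqP.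
rewrite /level; apply: leq_trans (leq_addl _ _).
rewrite -[n in n.-1]card_ord -(cardsC1 v) -(card_in_imset inj).
apply: subset_leq_card; apply/subsetP=> _ /imsetP[w wv ->].
by rewrite !inE in wv; rewrite !inE eqxx cards2 [v == w]eq_sym wv.
Qed.

Lemma card_free_rcons h e f : legal_offer h (e, f) ->
  (#|free_edges (rcons h (e, f))| < #|free_edges h|)%N.
Proof.
move=> /and3P[/= _ eh _]; rewrite free_edges_rcons (cardsD1 e (free_edges h)).
by rewrite eh ltnS subset_leq_card // subD1set.
Qed.

(** Offering two free edges at [v] preserves its level. With at most one free edge left there, the
    level is at most twice the Client degree plus 1, which [./2] absorbs. *)
Lemma forces_half_level h v K : (K <= level h v)%N ->
  forces (fun h' => game_over h' &&
            (K./2 <= degree (client_graph h') v)%N) h.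
Proof.
have [N] := ubnP #|free_edges h|; elim: N h => // N IH h hN Kh.
have [v2|v1] := ltnP 1 (degree (free_edges h) v).
  have /card_gt1P[e [f []]] := v2; rewrite !inE.
  move=> /andP[eh ve] /andP[fh vf] ef.
  have leg : legal_offer h (e, f) by rewrite /legal_offer /= ef !inE eh fh.
  have leg' : legal_offer h (f, e) by rewrite legal_offerC.
  apply: (forces_offer leg); apply: IH.
  - by have := card_free_rcons leg; lia.
  - by have := level_rcons v leg; rewrite ve vf; lia.
  - by have := card_free_rcons leg'; lia.
  - by have := level_rcons v leg'; rewrite ve vf; lia.
have {}Kh : (K./2 <= degree (client_graph h) v)%N.
  by move: Kh; rewrite /level; lia.
(* The rest is played out with arbitrary offers, since Client's degrees never decrease. *)
have {v1 IH hN} := hN; move: Kh => + _.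
have [M] := ubnP #|free_edges h|; elim: M h => // M IH h hM Kh.
have [over|h2] := boolP (game_over h); first by apply: forces_now; rewrite over.
move: h2; rewrite /game_over -leqNgt => /card_gt1P[e [f [eh fh ef]]].
have leg : legal_offer h (e, f) by rewrite /legal_offer /= ef eh fh.
have leg' : legal_offer h (f, e) by rewrite legal_offerC.
apply: (forces_offer leg); apply: IH.
- by have := card_free_rcons leg; lia.
- exact: leq_trans Kh (degree_client_rcons _ _ _ _).
- by have := card_free_rcons leg'; lia.
- exact: leq_trans Kh (degree_client_rcons _ _ _ _).
Qed.

(** * The exponential potential of the levels *)

Section Potential.
Variables (R : realFieldType) (x : R) (A : {set 'I_n}).
Hypothesis x1 : 1 < x.

Definition potential (S : {set 'I_n}) h : R := \sum_(a in S) x ^+ level h a.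

(** This is [(x + x^-1) / 2 - 1], the relative growth of two equal powers of [x] when one exponent
    rises by 1 and the other drops by 1. *)
Definition gain : R := (x - 1) ^+ 2 / (2 * x).

Let x0 : 0 < x := lt_trans ltr01 x1.

Lemma gain_ge0 : 0 <= gain.
Proof. by rewrite divr_ge0 ?sqr_ge0 ?mulr_ge0 ?ler0n ?(ltW x0). Qed.

Lemma geometric_sum_le K : \sum_(k < K) x ^+ k <= x ^+ K / (x - 1).
Proof.
by rewrite ler_pdivlMr ?subr_gt0 // mulrC -subrX1 gerBl ler01.
Qed.

Lemma potential_inj_le (S : {set 'I_n}) h K :
  {in S &, injective (level h)} -> (forall a, a \in S -> level h a < K)%N ->
  potential S h <= x ^+ K / (x - 1).
Proof.
move=> inj; case: K => [|K] ltK.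
  rewrite /potential big1 => [|a /ltK //].
  by rewrite divr_ge0 ?ler01 ?expr0 // subr_ge0 ltW.
apply: le_trans (geometric_sum_le _).
pose F a : 'I_K.+1 := inord (level h a).
have FE a : a \in S -> F a = level h a :> nat.
  by move=> /ltK aK; rewrite inordK.
have Finj : {in S &, injective F}.
  by move=> a b aS bS /(congr1 (@nat_of_ord _)); rewrite !FE //; apply: inj.
rewrite /potential (eq_bigr (fun a => x ^+ F a)) => [|a aS]; last by rewrite FE.
rewrite -(big_imset (fun k : 'I_K.+1 => x ^+ k)) //=.
rewrite [leRHS](bigID (mem (F @: S))) /= lerDl sumr_ge0 // => k _.
by rewrite exprn_ge0 ?(ltW x0).
Qed.

(** [S] holds the vertices not yet paired at [u]. What the pair adds to the potential of [A] is
    exactly [gain] times what it takes out of the potential of [S]. *)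
Lemma potential_rcons (S : {set 'I_n}) h u a b :
  S \subset A -> u \notin A -> a \in S -> b \in S -> a != b ->
  level h a = level h b ->
  let h' := rcons h ([set u; a], [set u; b]) in
  legal_offer h ([set u; a], [set u; b]) ->
  potential A h' + gain * potential (S :\ a :\ b) h' =
  potential A h + gain * potential S h.
Proof.
move=> SA uA aS bS ab lab h' leg.
have aA := subsetP SA a aS; have bA := subsetP SA b bS.
have lev c : c \in A -> (level h' c + (c == b) = level h c + (c == a))%N.
  move=> cA; have := level_rcons c leg; rewrite !inE.
  by have -> : (c == u) = false by apply: contraNF uA => /eqP <-.
have bS' : b \in S :\ a by rewrite !inE eq_sym ab.
have bA' : b \in A :\ a by rewrite !inE eq_sym ab.
have same (S' : {set 'I_n}) : S' \subset A ->
    potential (S' :\ a :\ b) h' = potential (S' :\ a :\ b) h.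
  move=> S'A; apply: eq_bigr => c; rewrite !inE => /and3P[cb ca cS'].
  have := lev c (subsetP S'A c cS').
  by rewrite (negPf cb) (negPf ca) !addn0 => ->.
have split (S' : {set 'I_n}) g : a \in S' -> b \in S' :\ a ->
    potential S' g =
    x ^+ level g a + (x ^+ level g b + potential (S' :\ a :\ b) g).
  by move=> aS' bS''; rewrite /potential (big_setD1 a) // (big_setD1 b).
rewrite same // !(split A) // (split S h) // same //.
have := lev a aA; have := lev b bA.
(* All powers are expressed through the lowered level of [b], so the identity left is
   [x^2 + 1 = 2 x + (x - 1)^2]. *)
rewrite !eqxx (negPf ab) eq_sym (negPf ab) lab !addn0 !addn1 => <- ->.
rewrite /gain !exprS; move: (x ^+ _) (potential _ _) (potential _ _) => X P P'.
by field; rewrite gt_eqF.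
Qed.

(* Waiter pairs up edges [ua], [ub] with [a], [b] of equal level: the level of
   [u] is unchanged, one of [a], [b] rises and the other drops, so the
   left-hand side below is preserved by [potential_rcons]. When no pair is left,
   the levels on [S] are distinct and geometric summation bounds the loss. *)
Lemma forces_star (S : {set 'I_n}) h u K :
  S \subset A -> u \notin A ->
  (forall a, a \in S -> [set u; a] \in free_edges h) ->
  forces (fun h' =>
    (exists v, K <= level h' v)%N \/
    potential A h + gain * potential S h <=
      potential A h' + gain * (x ^+ K / (x - 1)) /\
    (forall e, e \in free_edges h -> u \notin e -> e \in free_edges h')) h.
Proof.
have [N] := ubnP #|S|; elim: N S h => // N IH S h SN SA uA freeS.
have [/exists_inP[v vS Kv]|/exists_inPn small] :=
  boolP [exists v in S, (K <= level h v)%N].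
  by apply: forces_now; left; exists v.
have [/dinjectiveP inj|/dinjectivePn] := boolP (dinjectiveb (level h) S).
  apply: forces_now; right; split=> //.
  rewrite lerD2l ler_wpM2l ?gain_ge0 // potential_inj_le // => a aS.
  by rewrite ltnNge small.
move=> [a aS [b /andP[ba bS] lab]].
have ab : a != b by rewrite eq_sym.
have ua c : c \in S -> u != c.
  by move=> cS; apply: contraNneq uA => ->; apply: subsetP SA c cS.
have inj c d : c \in S -> d \in S -> [set u; c] = [set u; d] -> c = d.
  move=> cS dS /setP/(_ c); rewrite !inE eqxx orbT => /esym.
  by rewrite eq_sym (negPf (ua c cS)) => /eqP.
(* Stated for an ordered pair because Client decides which of the two levels rises. *)
have step c d : c \in S -> d \in S -> c != d -> level h c = level h d ->
    legal_offer h ([set u; c], [set u; d]) /\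
    forces (fun h' => (exists v, K <= level h' v)%N \/
      potential A h + gain * potential S h <=
        potential A h' + gain * (x ^+ K / (x - 1)) /\
      (forall e, e \in free_edges h -> u \notin e -> e \in free_edges h'))
      (rcons h ([set u; c], [set u; d])).
  move=> cS dS cd lcd.
  have leg : legal_offer h ([set u; c], [set u; d]).
    rewrite /legal_offer /= !freeS // !andbT.
    by apply: contraNneq cd => /(inj c d cS dS) ->.
  split=> //; have SA' : S :\ c :\ d \subset A.
    by apply: subset_trans SA; rewrite !subDset; apply/subsetP=> g gS;
       rewrite !inE gS !orbT.
  rewrite -(potential_rcons SA uA cS dS cd lcd leg).
  apply: forces_bind (IH (S :\ c :\ d) _ _ SA' uA _) _ => [|g|h'].
  - rewrite ltnS (cardsD1 c) cS in SN.
    exact: leq_ltn_trans (subset_leq_card (subD1set _ _)) SN.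
  - rewrite !in_setD1 => /and3P[gd gc gS].
    rewrite free_edges_rcons !in_setD1 freeS // !andbT.
    apply/andP; split; [apply: contraNneq gd|apply: contraNneq gc];
      by move/inj=> ->.
  - move=> [hit|[pot keep]]; apply: forces_now; [by left|right].
    split=> // e eh ue.
    apply: keep => //; rewrite free_edges_rcons !in_setD1 eh andbT.
    by apply/andP; split; apply: contraNneq ue => ->; rewrite !inE eqxx.
have [leg forces1] := step a b aS bS ab lab.
have [_ forces2] := step b a bS aS ba (esym lab).
exact: forces_offer leg forces1 forces2.
Qed.

(* With [U := x ^+ K / (x - 1)] bounding the potential of the vertices left
   unpaired at a center, [potential A - U] grows by a factor [1 + gain]. *)
Lemma forces_stars (B : seq 'I_n) h K : uniq B ->
  (forall u, u \in B -> u \notin A) ->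
  (forall u a, u \in B -> a \in A -> [set u; a] \in free_edges h) ->
  let U := x ^+ K / (x - 1) in
  forces (fun h' => (exists v, K <= level h' v)%N \/
    (1 + gain) ^+ size B * (potential A h - U) <= potential A h' - U) h.
Proof.
move=> + + + U; elim: B h => [|u B IH] h /=.
  by move=> _ _ _; apply: forces_now; right; rewrite mul1r.
move=> /andP[uB uniqB] BA freeB.
have uA : u \notin A by apply: BA; rewrite mem_head.
have freeu a : a \in A -> [set u; a] \in free_edges h.
  by move=> aA; apply: freeB; rewrite ?mem_head.
apply: forces_bind (forces_star K (subxx A) uA freeu) _ => h'.
move=> [hit|[pot keep]]; first by apply: forces_now; left.
apply: forces_bind (IH h' uniqB _ _) _ => [v vB|v a vB aA|h''].
- by apply: BA; rewrite inE vB orbT.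
- apply: keep; first by apply: freeB; rewrite // inE vB orbT.
  rewrite !inE negb_or; apply/andP; split.
    by apply: contraNneq uB => ->.
  by apply: contraNneq uA => ->.
- move=> [hit|pot']; apply: forces_now; [by left|right].
  apply: le_trans pot'; rewrite exprSr -mulrA.
  rewrite ler_wpM2l ?exprn_ge0 ?addr_ge0 ?gain_ge0 //.
  by move: pot; rewrite -/U; move: (potential _ _) (potential _ _) => P P'; lra.
Qed.
End Potential.

(** The first [m] vertices form [A], the others serve as centers. If all levels stayed below the
    target, the final potential would be at most [m * x ^+ (n.-1 + L)]; the growth from level [n.-1]
    exceeds this by the hypothesis, scaled by [x ^+ n.-1]. *)
Lemma forces_level (R : realFieldType) (x : R) (m L : nat) : (m <= n)%N ->
  1 < x ->
  m%:R * x ^+ L < (1 + gain x) ^+ (n - m) * (m%:R - x ^+ L / (x - 1)) ->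
  forces (fun h => exists v, n.-1 + L <= level h v)%N [::].
Proof.
move=> mn x1 big; pose A := [set v : 'I_n | (v < m)%N].
have x0 : 0 < x := lt_trans ltr01 x1.
have cardA : #|A| = m.
  rewrite -sum1dep_card -[RHS]card_ord -sum1_card.
  by rewrite -(big_ord_widen n (fun=> 1%N) mn).
have sizeB : size (enum (~: A)) = (n - m)%N.
  by rewrite -cardE cardsCs setCK cardA card_ord.
have BA u : u \in enum (~: A) -> u \notin A by rewrite mem_enum inE.
have freeB u a : u \in enum (~: A) -> a \in A -> [set u; a] \in free_edges [::].
  move=> /BA uA aA; rewrite !inE cards2 andbT.
  by have -> : u != a by apply: contraNneq uA => ->.
have stars := forces_stars x1 (n.-1 + L) (enum_uniq _) BA freeB.
apply: forces_bind stars _ => h' [hit|pot]; apply: forces_now => //.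
have [/existsP//|/existsPn small] := boolP [exists v, n.-1 + L <= level h' v]%N.
have sum_m (c : R) : \sum_(a in A) c = m%:R * c.
  by rewrite sumr_const cardA mulr_natl.
have pot_lb : m%:R * x ^+ n.-1 <= potential x A [::].
  by rewrite -sum_m ler_sum // => a _; rewrite ler_weXn2l ?ltW ?level0.
have pot_ub : potential x A h' <= m%:R * x ^+ (n.-1 + L).
  rewrite -sum_m ler_sum // => a _; rewrite ler_weXn2l ?(ltW x1) //.
  by rewrite ltnW // ltnNge small.
move: pot; rewrite sizeB leNgt => /negP[].
move: (potential _ _ _) (potential _ _ _) pot_lb pot_ub => P P' P_lb P'_ub.
have U0 : 0 < x ^+ (n.-1 + L) / (x - 1).
  by rewrite divr_gt0 ?exprn_gt0 ?subr_gt0.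
apply: (@lt_le_trans _ _ (m%:R * x ^+ (n.-1 + L))).
  by rewrite ltrBlDr ltr_pwDr.
apply: (@le_trans _ _ ((1 + gain x) ^+ (n - m) *
    (x ^+ n.-1 * (m%:R - x ^+ L / (x - 1))))).
  by rewrite exprD mulrCA [leRHS]mulrCA ler_pM2l ?exprn_gt0 // ltW.
rewrite ler_wpM2l ?exprn_ge0 ?addr_ge0 ?gain_ge0 //.
by rewrite mulrBr mulrA -exprD lerD2r mulrC.
Qed.
End Game.

(** * Real estimates for the growth of the potential *)

Lemma expR_le_gain (R : realType) (d : R) : 0 < d -> d <= 2^-1 ->
  expR (d ^+ 2 / 4) <= 1 + gain (1 + d).
Proof.
(* With [q = d^2]: [expR (q / 4) <= 1 / (1 - q / 4) <= 1 + q / 3 <= 1 + gain (1 + d)]. *)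
move=> d0 d2; have t1 : 0 < 1 - d ^+ 2 / 4 by nra.
have : 1 - d ^+ 2 / 4 <= (expR (d ^+ 2 / 4))^-1.
  by rewrite -expRN; apply: expR_ge1Dx.
rewrite -[leRHS]div1r ler_pdivlMr ?expR_gt0 //.
have : 1 <= (1 - d ^+ 2 / 4) * (1 + gain (1 + d)).
  have dg : d ^+ 2 / 3 <= gain (1 + d).
    rewrite /gain addrAC subrr add0r ler_wpM2l ?sqr_ge0 //.
    by rewrite lef_pV2 ?posrE; lra.
  apply: (@le_trans _ _ ((1 - d ^+ 2 / 4) * (1 + d ^+ 2 / 3))).
    have q0 := sqr_ge0 d; have q1 : d ^+ 2 <= 1 by nra.
    by move: (d ^+ 2) q0 q1 => q; nra.
  by rewrite ler_pM2l // lerD2l.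
move=> le1 le2; rewrite -(ler_pM2l t1); exact: le_trans le2 le1.
Qed.

Lemma ln_large (R : realType) : exists n0 : nat, forall n : nat, (n0 <= n)%N ->
  36 <= ln n%:R :> R.
Proof.
exists (Num.truncn (expR 36 : R)).+1 => n n0n.
have en : expR 36 < n%:R :> R.
  apply: lt_le_trans (truncnS_gt _) _; by rewrite ler_nat.
rewrite -[36]expRK ler_ln ?posrE ?expR_gt0 ?ltW //.
exact: lt_trans (expR_gt0 _) en.
Qed.

(** With [l = ln n], [x ^+ L] is at most about [expR (l / 250)], while the growth factor is at least
    [expR (l / 8)]; the unpaired loss costs at most half of [m]. *)
Lemma growth_condition (R : realType) (n m L : nat) :
  36 <= ln n%:R :> R -> n%:R / 3 <= m%:R :> R -> m%:R <= n%:R / 2 :> R ->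
  L%:R <= Num.sqrt (n%:R * ln n%:R) / 250 + 3 :> R ->
  let x : R := 1 + Num.sqrt (n%:R * ln n%:R) / n%:R in
  1 < x /\
  m%:R * x ^+ L < (1 + gain x) ^+ (n - m) * (m%:R - x ^+ L / (x - 1)).
Proof.
move=> + + +; have mnR := ler_nat R m n; set N : R := n%:R.
set l := ln N; set s := Num.sqrt _ => l36 m3 m2 Ls; set d := s / N.
have N0 : 0 < N.
  rewrite ltNge; apply: contraL l36 => /ln0; rewrite -/l => ->.
  by rewrite -ltNge ltr0n.
have l0 : 0 < l by apply: lt_le_trans l36; rewrite ltr0n.
have eN : expR (l / 2) ^+ 2 = N.
  by rewrite -expRM_natl mulrCA divff ?mulr1 ?pnatr_eq0 // lnK ?posrE.
have el : 1 + l / 2 <= expR (l / 2) by apply: expR_ge1Dx.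
have s2 : s ^+ 2 = N * l by rewrite sqr_sqrtr // mulr_ge0 // ltW.
have s0 : 0 < s by rewrite sqrtr_gt0 mulr_gt0.
have d0 : 0 < d by rewrite divr_gt0.
have dN : d * N = s by rewrite /d divfK ?gt_eqF.
have ds : d * s = l by rewrite /d mulrAC -expr2 s2 mulrAC divff ?mul1r ?gt_eqF.
have d2N : d ^+ 2 * N = l by rewrite expr2 -mulrA dN ds.
have d_le : d <= 2^-1.
  have lN : 4 * l <= N.
    have : (l / 2) ^+ 2 <= N.
      rewrite -eN ler_sqr ?nnegrE ?expR_ge0 ?divr_ge0 ?(ltW l0) //.
      by apply: le_trans el; rewrite lerDr.
    by apply: le_trans; move: l36 l0; clearbody l; clear; nra.
  have : d ^+ 2 <= 2^-1 ^+ 2.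
    rewrite -(ler_pM2r N0) d2N; move: lN; clearbody l N; clear; lra.
  by rewrite ler_sqr ?nnegrE ?(ltW d0) // invr_ge0.
(* The bound 36 on [l] serves here, as [6 ^ 2]; the 6 matches [m * d / 2 >= s / 6] below. *)
have s_ge : 6 * expR (l / 2) <= s.
  have : (6 * expR (l / 2)) ^+ 2 <= s ^+ 2.
    by rewrite exprMn eN s2 [N * l]mulrC ler_pM2r // (le_trans _ l36) //; lra.
  by rewrite ler_sqr ?nnegrE ?mulr_ge0 ?expR_ge0 ?(ltW s0) ?ler0n.
split; first by rewrite ltrDl.
have m0 : 0 < m%:R :> R by apply: lt_le_trans m3; rewrite divr_gt0.
(* [d * L <= l / 250 + 3 * d], and [d <= 1 / 2] makes the last term less than 2. *)
pose z := l / 250 + 2.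
have xL : (1 + d) ^+ L <= expR z.
  apply: (@le_trans _ _ (expR d ^+ L)).
    by rewrite lerXn2r ?nnegrE ?expR_ge0 ?expR_ge1Dx // addr_ge0 // ltW.
  rewrite -expRM_natl ler_expR mulrC.
  apply: le_trans (ler_wpM2l (ltW d0) Ls) _.
  by rewrite mulrDr mulrA ds /z; move: d_le; clear; lra.
have xLd : (1 + d) ^+ L / d <= m%:R / 2.
  rewrite ler_pdivrMr // (le_trans xL) //.
  have ez : expR z <= expR (l / 2).
    by rewrite ler_expR /z; move: l36; rewrite -/l; clear; lra.
  have : N / 3 * d <= m%:R * d by rewrite ler_pM2r.
  rewrite mulrAC [N * d]mulrC dN; move: ez s_ge; clear; lra.
(* The factor 2, bounded by [expR 1], pays for the half of [m] lost above. The exponent [l / 8] is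
   [d^2 / 4] times [n / 2], a lower bound on [n - m]. *)
have growth : 2 * (1 + d) ^+ L < (1 + gain (1 + d)) ^+ (n - m).
  have mn : (m <= n)%N by rewrite -mnR; move: m2 N0; rewrite -/N; clear; lra.
  apply: (@lt_le_trans _ _ (expR (d ^+ 2 / 4) ^+ (n - m))); last first.
    rewrite lerXn2r ?nnegrE ?expR_ge0 ?expR_le_gain // addr_ge0 //.
    by apply: gain_ge0; rewrite ltrDl.
  rewrite -expRM_natl; apply: (@lt_le_trans _ _ (expR (l / 8))); last first.
    rewrite ler_expR natrB // -/N -d2N.
    by have := sqr_ge0 d; move: (d ^+ 2) m2 => D; clear; nra.
  apply: (@le_lt_trans _ _ (expR 1 * expR z)).
    by apply: ler_pM; rewrite ?exprn_ge0 ?addr_ge0 ?(ltW d0) // expR_ge1Dx.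
  rewrite -expRD ltr_expR /z; move: l36; rewrite -/l; clear; lra.
rewrite [1 + d]addrC addrK [d + 1]addrC.
apply: (@lt_le_trans _ _ ((1 + gain (1 + d)) ^+ (n - m) * (m%:R / 2))).
  rewrite mulrCA ltr_pM2l // ltr_pdivlMr // mulrC; exact: growth.
rewrite ler_wpM2l ?exprn_ge0 ?addr_ge0 //; last by move: xLd; clear; lra.
by apply: gain_ge0; rewrite ltrDl.
Qed.

Theorem theorem1p2 (R : realType) :
  exists n0 : nat, forall n : nat, (n0 <= n)%N ->
    waiter_wins_WC n (n%:R / 2 + Num.sqrt (n%:R * ln n%:R) / 500 : R).
Proof.
have [n0 n0P] := ln_large R; exists (maxn 3 n0) => n.
rewrite geq_max => /andP[n3 /n0P l36].
(* Rounding leaves [L] at least 2 above [s / 250]: one unit pays for [n.-1], the other for the later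
   halving. *)
set s := Num.sqrt _; pose L := (Num.truncn (s / 250)).+3.
have s0 : 0 <= s / 250 by rewrite divr_ge0 ?sqrtr_ge0.
have [Ls1 Ls2] : s / 250 + 2 <= L%:R /\ L%:R <= s / 250 + 3.
  have /andP[] := truncn_itv s0; rewrite /L; move: (Num.truncn _) => t.
  by rewrite -[t.+3]addn3 -[t.+1]addn1 !natrD; lra.
have halfR : n%:R = (odd n)%:R + 2 * n./2%:R :> R.
  by rewrite -natrM mul2n -natrD odd_double_half.
have mn : (n./2 <= n)%N by lia.
have n3R : 3 <= n%:R :> R by rewrite ler_nat.
have [odd0 odd1] : 0 <= (odd n)%:R :> R /\ (odd n)%:R <= 1 :> R.
  by rewrite ler0n lern1 leq_b1.
(* [n >= 3] ensures [n./2 >= n / 3] also for odd [n]. *)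
have [||x1 growth] := growth_condition (m := n./2) l36 _ _ Ls2; [lra|lra|].
apply: forces_waiter_wins.
apply: forces_bind (forces_level mn x1 growth) _ => h [v].
move/forces_half_level => half; apply: forces_bind half _ => h' /andP[over Kv].
apply: forces_now; rewrite over /=; apply/forallPn; exists v; rewrite -leNgt.
move: (degree _ _) Kv => k Kk.
have : (n + L <= 2 * k + 2)%N by move: (L) Kk n3; clear; lia.
rewrite -(ler_nat R) natrD [leRHS]natrD natrM.
by move: Ls1; clearbody L s; clear; lra.
Qed.
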